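(* Let $(A,\nwarrow,\nearrow,\alpha)$ be a real $3$-Hom-L-dendriform algebra and let $J$ be an almost complex structure on $A$ (a linear map $J:A\to A$ with $J^2=-\mathrm{id}_A$) commuting with $\alpha$. If for all $x,y,z\in A$ $$\nwarrow(x,y,z)=-J\big(\nwarrow(x,y,Jz)+\nwarrow(Jx,y,z)+\nwarrow(x,Jy,z)\big),$$ $$\nearrow(x,y,z)=-J\big(\nearrow(x,y,Jz)+\nearrow(Jx,y,z)+\nearrow(x,Jy,z)\big),$$ then $J$ is a complex structure on $A$ (called a strong complex structure).
   Context: Vector spaces are finite-dimensional over $\mathbb R$ or $\mathbb C$; ''real'' means over $\mathbb R$. A $3$-Hom-L-dendriform algebra is a tuple $(A,\nwarrow,\nearrow,\alpha)$ where $A$ is a vector space, $\nwarrow,\nearrow:\otimes^3A\to A$ and $\alpha:A\to A$ are linear, $\alpha$ is multiplicative (i.e. $\alpha(\nwarrow(x,y,z))=\nwarrow(\alpha(x),\alpha(y),\alpha(z))$ and likewise for $\nearrow$), and, writing $\{x,y,z\}^h=\nwarrow(x,y,z)+\nearrow(x,y,z)-\nearrow(y,x,z)$, $\{x,y,z\}^v=\nwarrow(x,y,z)+\nearrow(z,x,y)-\nearrow(z,y,x)$, $[x,y,z]^C=\{x,y,z\}^h+\{y,z,x\}^h+\{z,x,y\}^h$ (equal to the same cyclic sum of $\{\cdot,\cdot,\cdot\}^v$), the following hold for all $x_1,\dots,x_5\in A$ (where $\circlearrowleft_{1,2,3}$ is the sum over cyclic permutations of the indices $1,2,3$): (0) $\nwarrow(x_1,x_2,x_3)+\nwarrow(x_2,x_1,x_3)=0$;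 (1) $\nwarrow(\alpha(x_1),\alpha(x_2),\nwarrow(x_3,x_4,x_5))-\nwarrow(\alpha(x_3),\alpha(x_4),\nwarrow(x_1,x_2,x_5))=\nwarrow([x_1,x_2,x_3]^C,\alpha(x_4),\alpha(x_5))-\nwarrow([x_1,x_2,x_4]^C,\alpha(x_3),\alpha(x_5))$; (2) $\nwarrow(\alpha(x_1),\alpha(x_2),\nearrow(x_5,x_3,x_4))-\nearrow(\alpha(x_5),\alpha(x_3),\{x_1,x_2,x_4\}^h)=\nearrow(\alpha(x_5),[x_1,x_2,x_3]^C,\alpha(x_4))+\nearrow(\{x_1,x_2,x_5\}^v,\alpha(x_3),\alpha(x_4))$; (3) $\nearrow(\alpha(x_5),\alpha(x_1),\{x_2,x_3,x_4\}^h)-\nwarrow(\alpha(x_2),\alpha(x_3),\nearrow(x_5,x_1,x_4))=\nearrow(\{x_1,x_2,x_5\}^v,\alpha(x_3),\alpha(x_4))-\nearrow(\{x_1,x_3,x_5\}^v,\alpha(x_2),\alpha(x_4))$; (4) $\nwarrow([x_1,x_2,x_3]^C,\alpha(x_4),\alpha(x_5))=\circlearrowleft_{1,2,3}\nwarrow(\alpha(x_1),\alpha(x_2),\nwarrow(x_3,x_4,x_5))$; (5) $\nearrow(\alpha(x_5),[x_1,x_2,x_3]^C,\alpha(x_4))=\circlearrowleft_{1,2,3}\nwarrow(\alpha(x_1),\alpha(x_2),\nearrow(x_5,x_3,x_4))$; (6) $\nwarrow(\alpha(x_1),\alpha(x_2),\nearrow(x_5,x_3,x_4))+\nearrow(\alpha(x_5),\alpha(x_1),\{x_2,x_3,x_4\}^h)=\nearrow(\alpha(x_5),\alpha(x_2),\{x_1,x_3,x_4\}^h)+\nearrow(\{x_1,x_2,x_5\}^v,\alpha(x_3),\alpha(x_4))$.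 A complex structure on $A$ is a linear map $J:A\to A$ with $J^2=-\mathrm{id}_A$ which is a Nijenhuis operator; equivalently $J^2=-\mathrm{id}_A$, $J\alpha=\alpha J$ and, for $\ast\in\{\nwarrow,\nearrow\}$ and all $x,y,z\in A$, $$J\ast(x,y,z)=-\ast(Jx,Jy,Jz)+\ast(Jx,y,z)+\ast(x,Jy,z)+\ast(x,y,Jz)+J\ast(Jx,Jy,z)+J\ast(x,Jy,Jz)+J\ast(Jx,y,Jz).$$ *)

(* Defs.v *)
(* The real numbers are any [R : realType] of
   MathComp-Analysis; the structures are defined over any field. *)
From HB Require Import structures.
From mathcomp Require Import all_boot all_order all_algebra.
From mathcomp Require Import reals.

Set Implicit Arguments.
Unset Strict Implicit.
Unset Printing Implicit Defensive.

Import GRing.Theory.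
Local Open Scope ring_scope.

(* Linear maps \otimes^3 A -> A are represented by trilinear maps. *)
Definition trilinear (K : fieldType) (A : vectType K) (f : A -> A -> A -> A) :
    Prop :=
  [/\ forall y z, linear (fun x => f x y z),
      forall x z, linear (fun y => f x y z)
    & forall x y, linear (fun z => f x y z)].

Definition cyclic_sum (A : zmodType) (f : A -> A -> A -> A) (x y z : A) : A :=
  f x y z + f y z x + f z x y.

Section DerivedBrackets.
Variables (A : zmodType) (nw ne : A -> A -> A -> A).

Definition hbracket (x y z : A) : A := nw x y z + ne x y z - ne y x z.

Definition vbracket (x y z : A) : A := nw x y z + ne z x y - ne z y x.

Definition Cbracket (x y z : A) : A := cyclic_sum hbracket x y z.

Lemma CbracketE x y z : Cbracket x y z = cyclic_sum vbracket x y z.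
Proof.
rewrite /Cbracket /cyclic_sum /hbracket /vbracket.
by rewrite [LHS](AC (3*3*3) ((1*8*6)*(4*2*9)*(7*5*3))).
Qed.

End DerivedBrackets.

(* [nw] and [ne] are the north-west and north-east arrows. *)
Record homLdendriform3 (K : fieldType) (A : vectType K) := HomLdendriform3 {
  nw : A -> A -> A -> A;
  ne : A -> A -> A -> A;
  alpha : 'End(A);
  nw_trilinear : trilinear nw;
  ne_trilinear : trilinear ne;
  alpha_nw : forall x y z, alpha (nw x y z) = nw (alpha x) (alpha y) (alpha z);
  alpha_ne : forall x y z, alpha (ne x y z) = ne (alpha x) (alpha y) (alpha z);
  nw_skew : forall x1 x2 x3, nw x1 x2 x3 + nw x2 x1 x3 = 0;
  dendriform1 : forall x1 x2 x3 x4 x5,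
    nw (alpha x1) (alpha x2) (nw x3 x4 x5)
      - nw (alpha x3) (alpha x4) (nw x1 x2 x5)
    = nw (Cbracket nw ne x1 x2 x3) (alpha x4) (alpha x5)
      - nw (Cbracket nw ne x1 x2 x4) (alpha x3) (alpha x5);
  dendriform2 : forall x1 x2 x3 x4 x5,
    nw (alpha x1) (alpha x2) (ne x5 x3 x4)
      - ne (alpha x5) (alpha x3) (hbracket nw ne x1 x2 x4)
    = ne (alpha x5) (Cbracket nw ne x1 x2 x3) (alpha x4)
      + ne (vbracket nw ne x1 x2 x5) (alpha x3) (alpha x4);
  dendriform3 : forall x1 x2 x3 x4 x5,
    ne (alpha x5) (alpha x1) (hbracket nw ne x2 x3 x4)
      - nw (alpha x2) (alpha x3) (ne x5 x1 x4)
    = ne (vbracket nw ne x1 x2 x5) (alpha x3) (alpha x4)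
      - ne (vbracket nw ne x1 x3 x5) (alpha x2) (alpha x4);
  dendriform4 : forall x1 x2 x3 x4 x5,
    nw (Cbracket nw ne x1 x2 x3) (alpha x4) (alpha x5)
    = cyclic_sum (fun a b c => nw (alpha a) (alpha b) (nw c x4 x5)) x1 x2 x3;
  dendriform5 : forall x1 x2 x3 x4 x5,
    ne (alpha x5) (Cbracket nw ne x1 x2 x3) (alpha x4)
    = cyclic_sum (fun a b c => nw (alpha a) (alpha b) (ne x5 c x4)) x1 x2 x3;
  dendriform6 : forall x1 x2 x3 x4 x5,
    nw (alpha x1) (alpha x2) (ne x5 x3 x4)
      + ne (alpha x5) (alpha x1) (hbracket nw ne x2 x3 x4)
    = ne (alpha x5) (alpha x2) (hbracket nw ne x1 x3 x4)
      + ne (vbracket nw ne x1 x2 x5) (alpha x3) (alpha x4)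
}.

Section ComplexStructure.
Variables (K : fieldType) (A : vectType K).

(* Reads [f(Nx,Ny,Nz) = N S2 - N^2 S1 + N^3 f(x,y,z)], where [Si] is the sum of
   the values of [f] with [N] applied to exactly [i] of the arguments. *)
Definition nijenhuis_for (N : 'End(A)) (f : A -> A -> A -> A) : Prop :=
  forall x y z,
    f (N x) (N y) (N z)
    = N (f (N x) (N y) z + f x (N y) (N z) + f (N x) y (N z))
      - N (N (f (N x) y z + f x (N y) z + f x y (N z)))
      + N (N (N (f x y z))).

Definition nijenhuis (D : homLdendriform3 A) (N : 'End(A)) : Prop :=
  [/\ forall x, N (alpha D x) = alpha D (N x),
      nijenhuis_for N (nw D)
    & nijenhuis_for N (ne D)].

Definition almost_complex (J : 'End(A)) : Prop := forall x, J (J x) = - x.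

Definition complex_structure (D : homLdendriform3 A) (J : 'End(A)) : Prop :=
  almost_complex J /\ nijenhuis D J.

Definition complex_integrable (J : 'End(A)) (f : A -> A -> A -> A) : Prop :=
  forall x y z,
    J (f x y z)
    = - f (J x) (J y) (J z) + f (J x) y z + f x (J y) z + f x y (J z)
      + J (f (J x) (J y) z) + J (f x (J y) (J z)) + J (f (J x) y (J z)).

Lemma complex_integrableP (J : 'End(A)) (f : A -> A -> A -> A) :
  almost_complex J -> nijenhuis_for J f <-> complex_integrable J f.
Proof.
move=> J2.
have E x y z :
    J (f (J x) (J y) z + f x (J y) (J z) + f (J x) y (J z))
      - J (J (f (J x) y z + f x (J y) z + f x y (J z)))
      + J (J (J (f x y z)))
    = f (J x) y z + f x (J y) z + f x y (J z) + J (f (J x) (J y) z)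
      + J (f x (J y) (J z)) + J (f (J x) y (J z)) - J (f x y z).
  rewrite !J2 opprK !linearD; congr (_ - _).
  by rewrite [LHS](AC (3*3) (4*5*6*1*2*3)).
have F (a b c d e g h : A) : - a + b + c + d + e + g + h
    = b + c + d + e + g + h - a by rewrite [LHS](ACl (2*3*4*5*6*7*1)).
split=> Jf x y z.
  by rewrite F (Jf x y z) E opprB addrCA subrr addr0.
by rewrite E (Jf x y z) F opprB addrCA subrr addr0.
Qed.

Lemma complex_structureP (D : homLdendriform3 A) (J : 'End(A)) :
  complex_structure D J <->
  [/\ almost_complex J, forall x, J (alpha D x) = alpha D (J x),
      complex_integrable J (nw D) & complex_integrable J (ne D)].
Proof.
split=> [[J2 [Ja Jnw Jne]] | [J2 Ja Jnw Jne]].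
  by split=> //; apply/(complex_integrableP _ J2).
by split=> //; split=> //; apply/(complex_integrableP _ J2).
Qed.

End ComplexStructure.

(* Main.v *)
(** With [Si] as in [nijenhuis_for], the hypothesis reads [J f = S1]. Applied at
    [(Jx, Jy, Jz)], together with [J^2 = -1], it gives [J f(Jx,Jy,Jz) = - S2], so
    the two integrability terms [- f(Jx,Jy,Jz) + J S2] cancel. *)
Require Import Defs.
From mathcomp Require Import all_boot all_order all_algebra.
From mathcomp Require Import reals.

Import GRing.Theory.
Local Open Scope ring_scope.

(** Each slot of a trilinear map is linear only as a predicate on a bare function, so its oddness is
    derived here from additivity. *)
Lemma linear_opp (K : pzRingType) (U V : lmodType K) (g : U -> V) :
  linear g -> {morph g : x / - x}.
Proof.
move=> /GRing.zmod_morphism_linear gB x.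
have g0 : g 0 = 0 by rewrite -[in LHS](subrr 0) gB subrr.
by rewrite -[in LHS](sub0r x) gB g0 sub0r.
Qed.

(** Stated for a single trilinear map so that it serves both arrows. *)
Lemma strong_complex_integrable (K : fieldType) (A : vectType K) (J : 'End(A))
    (f : A -> A -> A -> A) :
  trilinear f -> almost_complex J ->
  (forall x y z, f x y z = - J (f x y (J z) + f (J x) y z + f x (J y) z)) ->
  complex_integrable J f.
Proof.
move=> [lin1 lin2 lin3] J2 fE x y z.
have fNl u v w : f (- u) v w = - f u v w.
  exact: (linear_opp _ _ _ _ (lin1 v w)).
have fNm u v w : f u (- v) w = - f u v w.
  exact: (linear_opp _ _ _ _ (lin2 u w)).
have fNr u v w : f u v (- w) = - f u v w.
  exact: (linear_opp _ _ _ _ (lin3 u v)).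
(* In each summand of [fE] at [(J x, J y, J z)] one slot holds [J (J _)]; its sign leaves that slot
   and cancels the outer minus. *)
have fJJJ : f (J x) (J y) (J z)
    = J (f (J x) (J y) z) + J (f x (J y) (J z)) + J (f (J x) y (J z)).
  by rewrite fE !J2 fNl fNm fNr -!opprD linearN opprK !linearD.
have Jf : J (f x y z) = f (J x) y z + f x (J y) z + f x y (J z).
  by rewrite fE linearN /= J2 opprK [LHS](ACl (2*3*1)).
(* The right side is regrouped as [S1 + (- f (J x) (J y) (J z) + J S2)]; [fJJJ] makes the bracket
   vanish. *)
rewrite Jf [RHS](ACl ((2*3*4)*(1*(5*6*7)))) /=.
by rewrite -fJJJ addNr addr0.
Qed.

Theorem lemma4p17 (R : realType) (A : vectType R) (D : homLdendriform3 A)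
    (J : 'End(A)) :
  almost_complex J ->
  (forall x, J (alpha D x) = alpha D (J x)) ->
  (forall x y z : A,
    nw D x y z = - J (nw D x y (J z) + nw D (J x) y z + nw D x (J y) z)) ->
  (forall x y z : A,
    ne D x y z = - J (ne D x y (J z) + ne D (J x) y z + ne D x (J y) z)) ->
  complex_structure D J.
Proof.
move=> J2 Ja nwE neE; apply/complex_structureP; split=> //.
- exact: strong_complex_integrable (nw_trilinear D) J2 nwE.
- exact: strong_complex_integrable (ne_trilinear D) J2 neE.
Qed.
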